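(* Let $m\ge 0$ and $n\ge 3$ be integers. Let $p$ be a prime such that there exist integers $a\ge 0$ and $k\ge 0$ with \[\frac{mn(n-2)+\binom n2}{n(n-2)k+\binom n2-1}\le p^a\le\frac{mn}{nk+1}.\] Then the Hilbert series of the space $Q_m(n)$ of $m$-quasi-invariant polynomials in $n$ variables over $\mathbb F_p$ is different from the Hilbert series of $Q_m(n)$ over $\mathbb C$.
   Context: Let $K$ be a field, $n\ge1$ and $m\ge 0$ integers. A polynomial $F\in K[x_1,\dots,x_n]$ is called $m$-quasi-invariant if for all $1\le i,j\le n$ the polynomial $(x_i-x_j)^{2m+1}$ divides $F-s_{i,j}F$ in $K[x_1,\dots,x_n]$, where $s_{i,j}$ is the operator that swaps the variables $x_i$ and $x_j$. The space $Q_m(n)$ over $K$ is the set of all $m$-quasi-invariant polynomials in $K[x_1,\dots,x_n]$; it is a graded $K$-subspace. Its degree-$d$ part $Q_{m,d}(n)$ is the $K$-vector space of elements of $Q_m(n)$ that are homogeneous of degree $d$ (together with $0$), and the Hilbert series of $Q_m(n)$ over $K$ is $H_m(t)=\sum_{d\ge 0}t^d\dim_K Q_{m,d}(n)$. *)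

(* Defs.v *)
From HB Require Import structures.
From mathcomp Require Import all_boot all_order all_fingroup all_algebra.
From mathcomp Require Import boolp reals complex.
From mathcomp Require Import mpoly.

Set Implicit Arguments.
Unset Strict Implicit.
Unset Printing Implicit Defensive.

Import GRing.Theory.

Local Open Scope ring_scope.

(* An alias of [dhomog n K d] (the type of homogeneous polynomials of degree d,
   including 0) carrying a finite-dimensional vector space structure for every
   number n of variables; the library only provides it for [n.+1] variables. *)
Definition hompoly (n : nat) (K : fieldType) (d : nat) := dhomog n K d.

HB.instance Definition _ n K d := GRing.Lmodule.on (hompoly n K d).

Lemma hompoly_vecaxiom (n : nat) (K : fieldType) (d : nat) :
  Vector.axiom (if n is n'.+1 then 'C(d + n', d) else (d == 0)%N)
    (hompoly n K d).
Proof.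
case: n => [|n]; last exact: dhomog_vecaxiom.
have mon0 (u : 'X_{1..0}) : u = 0%MM by apply/mnmP; case.
exists (fun F : hompoly 0 K d => const_mx (mcoeff 0%MM (F : dhomog 0 K d))).
  by move=> c F G; apply/rowP=> i; rewrite !mxE /= mcoeffD mcoeffZ.
case: (eqVneq d 0%N) => [-> | d_neq0] /=.
  have hC (c : K) : c%:MP_[0] \is 0.-homog.
    by rewrite -[c%:MP_[0]]mulr1 mul_mpolyC dhomogZ ?dhomog1.
  exists (fun v : 'rV[K]_1 => DHomog (hC (v 0 0))) => [F | v].
    by apply/val_inj/mpolyP=> u; rewrite /= mxE (mon0 u) mcoeffC eqxx mulr1.
  by apply/rowP=> i; rewrite !mxE /= mcoeffC eqxx mulr1 ord1.
exists (fun=> 0) => [F | v]; last by apply/rowP; case.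
apply/val_inj/mpolyP=> u; rewrite /= mcoeff0 (mon0 u).
by rewrite (dhomog_nemf_coeff (dhomog_is_dhomog F)) ?mf0 1?eq_sym.
Qed.

HB.instance Definition _ n (K : fieldType) d :=
  Lmodule_hasFinDim.Build K (hompoly n K d) (hompoly_vecaxiom n K d).

Definition quasi_invariant (K : fieldType) (n m : nat) (F : {mpoly K[n]}) : Prop :=
  forall i j : 'I_n, exists G : {mpoly K[n]},
    F - msym (tperm i j) F = G * ('X_i - 'X_j) ^+ (2 * m + 1).

Lemma subspace_vspace (K : fieldType) (V : vectType K) (P : V -> Prop) :
    P 0 -> (forall (c : K) (u v : V), P u -> P v -> P (c *: u + v)) ->
  exists U : {vspace V}, forall v, v \in U <-> P v.
Proof.
move=> P0 PL.
suff ext (k : nat) (U : {vspace V}) : (forall v, v \in U -> P v) ->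
    (\dim {:V} - \dim U <= k)%N ->
    exists U : {vspace V}, forall v, v \in U <-> P v.
  by apply: (ext _ 0%VS _ (leqnn _)) => v; rewrite memv0 => /eqP->.
elim: k U => [|k IHk] U UP leUk.
all: have [PU | /existsNP[v /not_implyP[Pv /negP vU]]] :=
  pselect (forall v, P v -> v \in U); first by exists U => v; split; auto.
all: have ltU : (\dim U < \dim (U + <[v]>))%N.
all: try by rewrite (ltn_leqif (dimv_leqif_sup (addvSl _ _))) subv_add subvv.
all: have leV := dimvS (subvf (U + <[v]>)%VS).
  by move: leUk; rewrite leqn0 subn_eq0 leqNgt (leq_trans ltU leV).
apply: (IHk (U + <[v]>)%VS).
  move=> _ /memv_addP[u uU [_ /vlineP[c ->] ->]].
  by rewrite addrC; apply: PL => //; apply: UP.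
by rewrite -ltnS; apply: leq_trans leUk; rewrite ltn_sub2l // (leq_trans ltU).
Qed.

Lemma quasi_invariant_vspace (K : fieldType) (m n d : nat) :
  exists U : {vspace hompoly n K d},
    forall F : hompoly n K d, F \in U <-> quasi_invariant m (F : {mpoly K[n]}).
Proof.
apply: (@subspace_vspace K (hompoly n K d)
          (fun F => quasi_invariant m (F : {mpoly K[n]}))).
  by move=> i j; exists 0; rewrite /= msym0 subrr mul0r.
move=> c F1 F2 Q1 Q2 i j; have [G1 e1] := Q1 i j; have [G2 e2] := Q2 i j.
exists (c *: G1 + G2); rewrite mulrDl -scalerAl -e1 -e2 /=.
by rewrite msymD msymZ scalerBr opprD addrACA.
Qed.

(* The m-quasi-invariants homogeneous of degree d in n variables; characterized
   by [mem_Qdeg]. Classical choice turns the Prop-valued condition, closed under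
   linear combinations, into a subspace in the library's sense. *)
Definition Qdeg (K : fieldType) (m n d : nat) : {vspace hompoly n K d} :=
  projT1 (cid (quasi_invariant_vspace K m n d)).

Lemma mem_Qdeg (K : fieldType) (m n d : nat) (F : hompoly n K d) :
  F \in Qdeg K m n d <-> quasi_invariant m (F : {mpoly K[n]}).
Proof. exact: (projT2 (cid (quasi_invariant_vspace K m n d))). Qed.

(* A formal power series over nat, given as its sequence of coefficients. *)
Definition hilbert_series (K : fieldType) (m n : nat) : nat -> nat :=
  fun d => \dim (Qdeg K m n d).

(* Main.v *)
Require Import Defs.
From mathcomp Require Import all_boot all_order all_fingroup all_algebra.
From mathcomp Require Import reals complex mpoly ring zify.

Set Implicit Arguments.
Unset Strict Implicit.
Unset Printing Implicit Defensive.

Import Order.TTheory GRing.Theory Num.Theory.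
Local Open Scope ring_scope.

(** In characteristic 0, a quasi-invariant F of degree at most mn is symmetric, by induction
on the set of variables: for e >= m the coefficient of x_l^e is a quasi-invariant of degree
at most m(n-1) in the other variables, hence symmetric in them, so the monomials of
h = F - s_ij F have degree < m in x_i or in x_j. Differentiating m times in x_i leaves only
monomials of degree < m in x_j, and (x_i - x_j)^(2m+1) | h forces the result, then h itself,
to vanish.

In characteristic p, let P be the antiderivative of prod_j (z - x_j)^k between z = x_1 and
z = x_2, with denominators cleared and divided by the largest power of p dividing it before
being reduced modulo p. It is a quasi-invariant of order k and degree nk+1, divisible by
(x_1 - x_2)^(2k+1) but of degree at most k in x_3, so it is not symmetric. With q = p^a and
c = max(0, 2m+1 - (2k+1)q), the polynomial P^q prod_(j<i) (x_i - x_j)^c is a non-symmetric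
quasi-invariant of order m, and the two inequalities say that its degree is at most mn. Since
the space of symmetric polynomials of a given degree has the same dimension over both fields,
the Hilbert series differ in that degree. *)

Local Notation "m # s" := [multinom m (s i) | i < _]
  (at level 40, left associativity, format "m # s").

Lemma mcoeffMX_lt (n : nat) (R : nzRingType) (F : {mpoly R[n]}) (u v : 'X_{1..n}) :
  ~~ (u <= v)%MM -> (F * 'X_[u])@_v = 0.
Proof.
move=> nle; apply: memN_msupp_eq0; rewrite (perm_mem (msuppMX _ _)).
by apply: contra nle => /mapP[w _ ->]; apply: lem_addr.
Qed.

Lemma msymXU (n : nat) (R : comNzRingType) (s : 'S_n) (i : 'I_n) :
  msym s ('X_i : {mpoly R[n]}) = 'X_(s i).
Proof.
rewrite msymX; congr 'X_[_]; apply/mnmP => j; rewrite mnmE !mnm1E.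
by rewrite (can2_eq (permK s) (permKV s)).
Qed.

(** * Degrees, in one variable, of multiples of powers of $x_i - x_j$ *)

Section LinearPowers.
Variables (n : nat) (R : comNzRingType).
Implicit Types (F G H : {mpoly R[n]}) (u v : 'X_{1..n}) (i j : 'I_n).

(** Induction on the exponent of $x_i$: the coefficient of [G * ('X_i - 'X_j)] at [U_(j) + u] ties
    [G@_u] to the coefficient of [G] at the monomial with one $x_i$ fewer and one $x_j$ more. *)
Lemma mulXB_degree i j G N : i != j ->
    (forall u, (N < u j)%N -> (G * ('X_i - 'X_j))@_u = 0) ->
  forall u, (N <= u j)%N -> G@_u = 0.
Proof.
move=> ij GX u; have [s] := ubnP (u i); elim: s u => // s IHs u us Nu.
have := GX (U_(j) + u)%MM; rewrite mnmDE mnm1E eqxx ltnS => /(_ Nu).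
rewrite mulrBr mcoeffB mcoeffMX => /eqP; rewrite subr_eq add0r => /eqP <-.
have [u0|u0] := eqVneq (u i) 0%N.
  by rewrite mcoeffMX_lt // lep1mP mnmDE mnm1E [j == i]eq_sym (negPf ij) u0.
have le_u : (U_(i) <= U_(j) + u)%MM.
  by rewrite lep1mP mnmDE mnm1E [j == i]eq_sym (negPf ij).
rewrite -(submK le_u) addmC mcoeffMX IHs //.
  by rewrite mnmBE mnmDE !mnm1E eqxx ?(negPf ij) ?[j == i]eq_sym ?(negPf ij); lia.
by rewrite mnmBE mnmDE !mnm1E eqxx ?(negPf ij) ?[j == i]eq_sym ?(negPf ij); lia.
Qed.

(** The coefficient of $x_j$ in $x_i - x_j$ is the unit $-1$, so each factor raises the degree in
    $x_j$ of a nonzero polynomial by one, over any coefficient ring. *)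
Lemma mulXB_exp_eq0 i j G N : i != j ->
  (forall u, (N <= u j)%N -> (G * ('X_i - 'X_j) ^+ N)@_u = 0) -> G = 0.
Proof.
move=> ij; elim: N G => [|N IHN] G GX.
  by apply/mpolyP => u; rewrite mcoeff0 -[G]mulr1; apply: GX.
apply: IHN => u; apply: (mulXB_degree ij) => v Nv.
by rewrite -mulrA -exprSr GX.
Qed.

Lemma mulXB_exp_eq0l i j G N : i != j ->
  (forall u, (N <= u i)%N -> (G * ('X_i - 'X_j) ^+ N)@_u = 0) -> G = 0.
Proof.
move=> ij GX; have : (-1) ^+ N * G = 0.
  apply: (@mulXB_exp_eq0 j i _ N) => [|u Nu]; first by rewrite eq_sym.
  by rewrite mulrAC -exprMn mulN1r opprB mulrC GX.
by move/(congr1 ( *%R ((-1) ^+ N))); rewrite mulr0 signrMK.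
Qed.

Lemma mderiv_mulXB_exp i j G N :
  exists G', mderiv i (G * ('X_i - 'X_j) ^+ N.+1) = G' * ('X_i - 'X_j) ^+ N.
Proof.
elim: N G => [|N IHN] G.
  by exists (mderiv i (G * ('X_i - 'X_j))); rewrite expr1 expr0 mulr1.
have [G' e] := IHN G.
exists (G' + G * mderiv i ('X_i - 'X_j)).
by rewrite exprSr mulrA mderivM e mulrDl -!mulrA -exprSr [mderiv _ _ * _]mulrC.
Qed.

(* Differentiating k times in x_i kills the part of degree < k in x_i, and what
   remains is too small in x_j to be divisible by (x_i - x_j)^l. *)
Lemma mulXB_exp_degree_eq0 i j G k l : i != j ->
    (forall c : R, forall s : nat, c *+ s.+1 = 0 -> c = 0) ->
    (forall u, (k <= u i)%N -> (l <= u j)%N ->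
       (G * ('X_i - 'X_j) ^+ (k + l))@_u = 0) ->
  G = 0.
Proof.
move=> ij char0; elim: k G => [|k IHk] G GX.
  by apply: (@mulXB_exp_eq0 i j G l) => // u; apply: GX.
have [G' eG] := mderiv_mulXB_exp i j G (k + l).
have G'0 : G' = 0.
  apply: IHk => u ku lu; rewrite -eG mcoeff_deriv -addSn GX ?mul0rn //.
    by rewrite mnmDE mnm1E eqxx; lia.
  by rewrite mnmDE mnm1E (negPf ij) addn0.
(* As the derivative vanishes, characteristic 0 leaves no monomial containing $x_i$ in the multiple
   of $(x_i - x_j)^{k+1+l}$. *)
apply: (@mulXB_exp_eq0l i j G (k.+1 + l)) => // u ku.
have ui : (U_(i) <= u)%MM by rewrite lep1mP; lia.
rewrite -(submK ui); apply: (char0 _ ((u - U_(i))%MM i)).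
by rewrite -mcoeff_deriv addSn eG G'0 mul0r mcoeff0.
Qed.

End LinearPowers.

(** * Keeping only the monomials that satisfy a predicate *)

Section Truncation.
Variables (n : nat) (R : comNzRingType) (P : pred 'X_{1..n}).
Implicit Types (F G : {mpoly R[n]}) (u v : 'X_{1..n}) (i j : 'I_n).

Definition mtrunc F : {mpoly R[n]} := \sum_(u <- msupp F | P u) F@_u *: 'X_[u].

Lemma mcoeff_trunc F u : (mtrunc F)@_u = if P u then F@_u else 0.
Proof.
rewrite /mtrunc (raddf_sum (mcoeff u)) /=.
under eq_bigr do rewrite mcoeffZ mcoeffX.
case: ifPn => Pu; last first.
  by rewrite big1 // => v Pv; case: eqVneq => [vu|_]; rewrite ?mulr0 //; rewrite -vu Pv in Pu.
have [Fu|Fu] := boolP (u \in msupp F).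
  rewrite big_mkcond (bigD1_seq u) ?msupp_uniq //= Pu eqxx mulr1 big1 ?addr0 // => v vu.
  by rewrite (negPf vu) mulr0 if_same.
rewrite (memN_msupp_eq0 Fu) big_seq_cond big1 // => v /andP[Fv _].
by case: eqVneq Fv Fu => [->|_]; [move=> -> | rewrite mulr0].
Qed.

Lemma mtruncB F G : mtrunc (F - G) = mtrunc F - mtrunc G.
Proof.
by apply/mpolyP => u; rewrite mcoeffB !mcoeff_trunc mcoeffB; case: ifP; rewrite ?subr0.
Qed.

Lemma mtrunc_sym F (s : 'S_n) :
  (forall u, P (u # s) = P u) -> mtrunc (msym s F) = msym s (mtrunc F).
Proof.
by move=> Ps; apply/mpolyP => u; rewrite mcoeff_sym !mcoeff_trunc mcoeff_sym Ps.
Qed.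

Lemma mtruncMX F i : (forall u, P (U_(i) + u)%MM = P u) ->
  mtrunc (F * 'X_i) = mtrunc F * 'X_i.
Proof.
move=> Pi; apply/mpolyP => u; rewrite mcoeff_trunc.
have [iu|iu] := boolP (U_(i) <= u)%MM; last by rewrite !mcoeffMX_lt ?if_same.
by rewrite -(submK iu) addmC !mcoeffMX mcoeff_trunc Pi.
Qed.

(** A predicate blind to $x_i$ and $x_j$ makes truncation linear over polynomials in these two
    variables, so divisibility survives. *)
Lemma mtruncMXB_exp F i j N :
    (forall u, P (U_(i) + u)%MM = P u) -> (forall u, P (U_(j) + u)%MM = P u) ->
  mtrunc (F * ('X_i - 'X_j) ^+ N) = mtrunc F * ('X_i - 'X_j) ^+ N.
Proof.
move=> Pi Pj; elim: N F => [|N IHN] F; first by rewrite !mulr1.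
by rewrite exprS !mulrA IHN !mulrBr mtruncB !mtruncMX.
Qed.

End Truncation.

(** * Quasi-invariants of low degree in characteristic 0 *)

Section LowDegree.
Variables (n m : nat) (R : comNzRingType).
Hypothesis char0 : forall (c : R) (s : nat), c *+ s.+1 = 0 -> c = 0.
Implicit Types (F G : {mpoly R[n]}) (u v : 'X_{1..n}) (i j : 'I_n).

(** Variables outside [S] are parameters, and only the degree in [S] is bounded. This suits the
    induction: fixing an exponent at least $m$ in one variable of [S] leaves at most $m(|S|-1)$ for
    the others. *)
Lemma low_degree_sym (S : {set 'I_n}) F :
    (forall i j, i \in S -> j \in S ->
       exists G, F - msym (tperm i j) F = G * ('X_i - 'X_j) ^+ (2 * m + 1)) ->
    (forall u, F@_u != 0 -> (\sum_(i in S) u i <= m * #|S|)%N) ->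
  forall i j, i \in S -> j \in S -> msym (tperm i j) F = F.
Proof.
have [s] := ubnP #|S|; elim: s S F => // s IHs S F leS QF dF i j iS jS.
have [->|ij] := eqVneq i j; first by rewrite tperm1 msym1m.
(* The part of F of a given degree >= m in x_l falls under the induction hypothesis for the
   remaining variables. *)
have symF l a b u : l \in S -> a \in S -> b \in S -> a != l -> b != l ->
    (m <= u l)%N -> F@_(u # tperm a b) = F@_u.
  move=> lS aS bS al bl mu; pose P v := v l == u l.
  have Pt a' b' v : a' != l -> b' != l -> P (v # tperm a' b') = P v.
    by move=> ? ?; rewrite /P mnmE tpermD.
  have PX a' v : a' != l -> P (U_(a') + v)%MM = P v.
    by move=> a'l; rewrite /P mnmDE mnm1E (negPf a'l).
  have /(congr1 (mcoeff u)) : msym (tperm a b) (mtrunc P F) = mtrunc P F.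
    apply: (IHs (S :\ l)); rewrite ?inE ?al ?bl //.
    - by move: leS; rewrite (cardsD1 l) lS.
    - move=> a' b' /setD1P[a'l a'S] /setD1P[b'l b'S].
      have [G e] := QF a' b' a'S b'S; exists (mtrunc P G).
      rewrite -mtrunc_sym -?mtruncB ?e ?mtruncMXB_exp // => v; try exact: PX.
      exact: Pt.
    move=> v; rewrite mcoeff_trunc; case: ifP => [/eqP vl|]; last by rewrite eqxx.
    move=> /dF; rewrite (cardsD1 l) lS (big_setD1 l) //= vl mulnDr muln1 => le_d.
    by rewrite -(leq_add2l m); apply: leq_trans le_d; rewrite leq_add2r.
  by rewrite mcoeff_sym !mcoeff_trunc Pt // /P eqxx.
have [G e] := QF i j iS jS; suff G0 : G = 0.
  by apply/eqP; rewrite eq_sym -subr_eq0 e G0 mul0r.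
(* The exponent $2m+1$ splits into $m$ for each of $x_i$ and $x_j$, and one spare factor that joins
   the cofactor. *)
have {}e : F - msym (tperm i j) F = (G * ('X_i - 'X_j)) * ('X_i - 'X_j) ^+ (m + m).
  by rewrite e addn1 mul2n -addnn exprS mulrA.
have /(@mulXB_exp_eq0 _ _ i j G 1 ij) : forall u, (1 <= u j)%N -> (G * ('X_i - 'X_j) ^+ 1)@_u = 0.
  move=> u _; rewrite expr1; suff -> : G * ('X_i - 'X_j) = 0 by rewrite mcoeff0.
  apply: (mulXB_exp_degree_eq0 ij char0 (k := m) (l := m)) => {}u mi mj.
  rewrite -e mcoeffB mcoeff_sym; apply/eqP; rewrite subr_eq0 eq_sym.
  (* With a third variable $x_l$, the swap of $i$ and $j$ is a product of three transpositions, each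
     applied while the variable it fixes has exponent at least $m$. *)
  have [l /andP[lS /andP[li lj]]|noS] := pickP [pred l in S | (l != i) && (l != j)].
    have [ji [il jl]] : j != i /\ (i != l /\ j != l) by do ?split; rewrite eq_sym.
    rewrite -(symF i j l u) // -(symF l i j (u # tperm j l)) ?mnmE ?tpermR //.
    rewrite -(symF j i l (u # tperm j l # tperm i j)) ?mnmE ?tpermR ?tpermD //.
apply/eqP; congr (F@__); apply/mnmP => x; rewrite !mnmE.

    have [<-|xi] := eqVneq i x; first by rewrite !tpermL (tpermD il jl) tpermR.
    have [<-|xj] := eqVneq j x; first by rewrite (tpermD ij lj) tpermR tpermD.
    have [<-|xl] := eqVneq l x; first by rewrite (tpermD il jl) !(tpermR, tpermL).
    by rewrite !tpermD.
  (* With only two variables the degree is at most $2m$, so exponents that are both at least $m$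
     both equal $m$, and the swap fixes the monomial. *)
  have S2 : S = [set i; j].
    apply/setP => l; rewrite !inE; have := noS l; rewrite /=.
    by case: eqVneq => [->|_]; case: eqVneq => [->|_]; rewrite ?iS ?jS ?andbT.
  have dF2 v : F@_v != 0 -> (v i + v j <= m * 2)%N.
    by move=> /dF; rewrite S2 cards2 ij big_setU1 ?inE //= big_set1.
  have [uu|] := eqVneq (u # tperm i j) u; first by rewrite uu.
  have [->|/dF2 uij] := eqVneq (F@_u) 0.
    have [//|/dF2] := eqVneq (F@_(u # tperm i j)) 0.
    rewrite !mnmE tpermL tpermR => uij /eqP[]; apply/mnmP => x; rewrite mnmE.
    by case: tpermP => // ->; lia.
  move=> /eqP[]; apply/mnmP => x; rewrite mnmE.
  by case: tpermP => // ->; lia.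
by [].
Qed.

End LowDegree.

(** * Dimension of the symmetric polynomials of a given degree *)

Section SymmetricDimension.
Variables (n d : nat) (K : fieldType).
Implicit Types (u v w : 'X_{1..n}) (F : hompoly n K d).

(** One representative per orbit of monomials, that is, the partitions of $d$ into at most $n$
    parts. *)
Definition partition_mnm : seq 'X_{1..n} :=
  [seq bmnm b | b : 'X_{1..n < d.+1} <- enum {: 'X_{1..n < d.+1}} & (mdeg b == d) && sorted leq b].

Lemma mem_partition_mnm u : (u \in partition_mnm) = (mdeg u == d) && sorted leq u.
Proof.
apply/mapP/andP => [[v] | [/eqP du su]].
  by rewrite mem_filter => /andP[/andP[dv sv] _] ->.
have ud : (mdeg u < d.+1)%N by rewrite du.
by exists (BMultinom ud); rewrite // mem_filter du eqxx su mem_enum.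
Qed.

Lemma partition_mnm_uniq : uniq partition_mnm.
Proof.
rewrite map_inj_uniq ?filter_uniq -?enumT ?enum_uniq //.
by move=> x y xy; apply/eqP; rewrite bmeqP xy.
Qed.

Lemma perm_eq_mdeg u v : perm_eq u v -> mdeg u = mdeg v.
Proof. by move=> uv; rewrite /mdeg; apply: perm_big. Qed.

Lemma perm_mnmP u v : reflect (exists s : 'S_n, u = v # s) (perm_eq u v).
Proof.
apply: (iffP tuple_permP) => [[s e] | [s ->]]; exists s.
  have {}e : multinom_val u = [tuple tnth (multinom_val v) (s i) | i < n].
    exact: val_inj.
  by apply/mnmP => i; rewrite mnmE mnm_tnth e tnth_mktuple.
by congr val; apply/eq_from_tnth => i; rewrite !tnth_mktuple.
Qed.

Definition sort_mnm u : 'X_{1..n} := Multinom (sort_tuple leq u).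

Lemma perm_sort_mnm u : perm_eq (sort_mnm u) u.
Proof. by rewrite /= perm_sort. Qed.

Lemma sorted_mnm_eq u v :
  sorted leq u -> sorted leq v -> perm_eq u v -> u = v.
Proof.
move=> su sv uv; do 2!apply: val_inj.
exact: (sorted_eq leq_trans anti_leq su sv uv).
Qed.

(** The monomial symmetric polynomial. Summing over distinct rearrangements instead of permutations
    keeps its coefficients equal to 1 in every characteristic. *)
Definition monomial_sym u : {mpoly K[n]} :=
  \sum_(b : 'X_{1..n < d.+1}) (perm_eq b u)%:R *: 'X_[b].

Lemma mcoeff_monomial_sym u v :
  mdeg u = d -> (monomial_sym u)@_v = (perm_eq v u)%:R.
Proof.
move=> du; have [vd|vd] := ltnP (mdeg v) d.+1.
  by rewrite (mcoeff_mpoly (fun v => (perm_eq v u)%:R)).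
rewrite /monomial_sym (raddf_sum (mcoeff v)) /= big1 => [|w _].
  by case: (boolP (perm_eq v u)) => // /perm_eq_mdeg; lia.
rewrite mcoeffZ mcoeffX; have [wv|] := eqVneq; rewrite ?mulr0 //.
by have := bmdeg w; rewrite wv; lia.
Qed.

Lemma monomial_sym_homog u : mdeg u = d -> monomial_sym u \is d.-homog.
Proof.
move=> du; apply/dhomogP => v; rewrite mcoeff_msupp mcoeff_monomial_sym //.
by case: (boolP (perm_eq v u)) => [/perm_eq_mdeg vu _|]; [apply: etrans vu du | rewrite eqxx].
Qed.

Lemma monomial_sym_sym u : mdeg u = d -> monomial_sym u \is symmetric.
Proof.
move=> du; apply/issymP => s; apply/mpolyP => v.
have /permPl vs : perm_eq (v # s) v by apply/perm_mnmP; exists s.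
by rewrite mcoeff_sym !mcoeff_monomial_sym // vs.
Qed.

Definition monomial_hom u : hompoly n K d := indhomog d (monomial_sym u).

Lemma val_monomial_hom u :
  mdeg u = d -> val (monomial_hom u : dhomog n K d) = monomial_sym u.
Proof. by move=> du; rewrite insubdK // monomial_sym_homog. Qed.

(** The monomial symmetric polynomials form a basis, and their number does not depend on the
    field. *)
Lemma symmetric_vspace :
  exists W : {vspace hompoly n K d},
    (forall F, F \in W <-> (F : {mpoly K[n]}) \is symmetric) /\
    \dim W = size partition_mnm.
Proof.
have [||W memW] := @subspace_vspace K (hompoly n K d)
   (fun F => (F : {mpoly K[n]}) \is symmetric).
- exact: rpred0.
- by move=> c F G sF sG; rewrite /= rpredD // rpredZ.
exists W; split=> //; set P := partition_mnm.
have degP u : u \in P -> mdeg u = d.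
  by rewrite mem_partition_mnm => /andP[/eqP].
pose X := map_tuple monomial_hom (in_tuple P).
have bP (u v : 'X_{1..n}) : u \in P -> v \in P -> perm_eq u v = (u == v).
  rewrite !mem_partition_mnm => /andP[_ su] /andP[_ sv].
  by apply/idP/eqP => [/sorted_mnm_eq->|-> //].
have valsum (I : Type) (r : seq I) (k : I -> K) (g : I -> 'X_{1..n}) v :
    (forall i, g i \in P) ->
  ((\sum_(i <- r) k i *: monomial_hom (g i) : hompoly n K d) : {mpoly K[n]})@_v
    = \sum_(i <- r) k i * (perm_eq v (g i))%:R.
  move=> gP; rewrite !raddf_sum /=; apply: eq_bigr => i _.
  by rewrite mcoeffZ val_monomial_hom ?mcoeff_monomial_sym // degP.
pose g (i : 'I_(size P)) := nth 0%MM P i.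
have gP i : g i \in P by apply: mem_nth.
suff bX : basis_of W X by rewrite (vector.size_basis bX).
apply/andP; split.
  rewrite eqEsubv; apply/andP; split.
    apply/span_subvP => _ /mapP[u uX ->]; apply/memW.
    by rewrite val_monomial_hom ?monomial_sym_sym ?degP.
  apply/subvP => F /memW sF.
  (* A symmetric polynomial has constant coefficients on orbits, so its coordinates are read off at
     the sorted exponents. *)
  have -> : F = \sum_(i < size P) (F : {mpoly K[n]})@_(g i) *: monomial_hom (g i).
    apply/val_inj/mpolyP => v; rewrite valsum //.
    have [dv|dv] := eqVneq (mdeg v) d; last first.
      rewrite (dhomog_nemf_coeff (dhomog_is_dhomog F) dv) big1 // => i _.
      case: (boolP (perm_eq v (g i))) => [/perm_eq_mdeg e|_]; last by rewrite mulr0.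
      by rewrite e degP // eqxx in dv.
    have vP : sort_mnm v \in P.
      rewrite mem_partition_mnm (perm_eq_mdeg (perm_sort_mnm v)) dv eqxx.
      exact: (sort_sorted leq_total).
    rewrite -(big_mkord xpredT (fun i => F@_(nth 0%MM P i) * (perm_eq v (nth 0%MM P i))%:R)).
    rewrite -(big_nth 0%MM xpredT (fun u => F@_u * (perm_eq v u)%:R)).
    rewrite (bigD1_seq (sort_mnm v)) ?partition_mnm_uniq //= big_seq_cond big1.
      rewrite addr0 perm_sym perm_sort_mnm mulr1.
      by have /perm_mnmP[s ->] := perm_sort_mnm v; rewrite msym_coeff.
    move=> u /andP[uP uv]; rewrite -(permPl (perm_sort_mnm v)) bP // eq_sym (negPf uv).
    by rewrite mulr0.
  apply: memv_suml => i _; apply: memvZ; apply: memv_span.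
  by apply/mapP; exists (g i).
apply/freeP => k k0 i.
have := congr1 (fun F : hompoly n K d => (F : {mpoly K[n]})@_(g i)) k0.
rewrite mcoeff0 (eq_bigr (fun i => k i *: monomial_hom (g i))) => [|j _].
  rewrite valsum // (bigD1 i) //= perm_refl mulr1 big1 ?addr0 // => j ji.
  rewrite bP // nth_uniq ?partition_mnm_uniq //.
  by case: (eqVneq (i : nat) j) ji => [/ord_inj-> | _ _]; rewrite ?eqxx // mulr0.
by rewrite (nth_map 0%MM).
Qed.

End SymmetricDimension.

(** The symmetric polynomials have equal dimensions over both fields; they contain the
    quasi-invariants over [L] and lie strictly inside those over [K], as [F] shows. *)
Lemma hilbert_series_lt (K L : fieldType) (m n d : nat) (F : hompoly n K d) :
    (forall G : hompoly n L d, quasi_invariant m (G : {mpoly L[n]}) ->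
       (G : {mpoly L[n]}) \is symmetric) ->
    quasi_invariant m (F : {mpoly K[n]}) -> (F : {mpoly K[n]}) \isn't symmetric ->
  (hilbert_series L m n d < hilbert_series K m n d)%N.
Proof.
move=> symL QF nsF.
have [V [memV dimV]] := symmetric_vspace n d L.
have [W [memW dimW]] := symmetric_vspace n d K.
have leV : (\dim (Qdeg L m n d) <= \dim V)%N.
  by apply: dimvS; apply/subvP => G /mem_Qdeg/symL/memV.
have subW : (W <= Qdeg K m n d)%VS.
  apply/subvP => G /memW/issymP sG; apply/mem_Qdeg => i j.
  by exists 0; rewrite mul0r sG subrr.
apply: leq_ltn_trans leV _; rewrite dimV -dimW.
rewrite (ltn_leqif (dimv_leqif_sup subW)).
by apply: contra nsF => /subvP/(_ F); rewrite mem_Qdeg memW; apply.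
Qed.

(** * Divisibility of integrals between two roots of the integrand *)

Section Primitive.
Variable A : idomainType.
Hypothesis char0 : forall (c : A) (s : nat), c *+ s.+1 = 0 -> c = 0.
Implicit Types (T M Psi : {poly A}) (a b : A).

(** The left side comes from differentiating $(z-b)^{c+1}T$. At $z=b$ it gives $(c+1)T(b)=0$, so a
    factor $z-b$ splits off [T], turning [c] into $c+1$ and [s] into $s-1$. *)
Lemma euler_divXsubC s c T M b :
    T *+ c.+1 + ('X - b%:P) * T^`() = ('X - b%:P) ^+ s * M ->
  exists2 T1, T = ('X - b%:P) ^+ s * T1 &
    T1 *+ (c + s).+1 + ('X - b%:P) * T1^`() = M.
Proof.
elim: s c T => [|s IHs] c T eT.
  by exists T; rewrite ?mul1r // addn0 eT mul1r.
have /factor_theorem[q eq] : root T b.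
  apply/rootP/(@char0 _ c); have := congr1 (horner^~ b) eT.
  by rewrite !hornerE hornerMn subrr exprS !mul0r addr0.
have [|T1 eq1 eT1] := IHs c.+1 q.
  apply: (@mulfI _ ('X - b%:P)); first by rewrite polyXsubC_eq0.
  rewrite mulrA -exprS -eT eq derivM derivXsubC mulr1 mulrS -mulrnAl.
  by move: (q *+ _) q^`() ('X - _) => Q q' D; ring.
exists T1; last by rewrite addnS.
by rewrite eq eq1 exprS mulrC mulrA.
Qed.

Lemma primitive_divXsubC s Psi M b :
    Psi^`() = ('X - b%:P) ^+ s * M -> root Psi b ->
  exists2 T, Psi = ('X - b%:P) ^+ s.+1 * T &
    T *+ s.+1 + ('X - b%:P) * T^`() = M.
Proof.
move=> dPsi /factor_theorem[q eq].
have [|T eT eM] := @euler_divXsubC s 0 q M b.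
  by rewrite -dPsi eq derivM derivXsubC mulr1 mulr1n addrC mulrC.
by exists T; rewrite // eq eT mulrC mulrA exprS.
Qed.

(** For $r>0$, evaluation at $a$ gives $(c+1)T(a) = -(a-b)T'(a)$, and differentiation gives an
    equation of the same shape for $T'$ with $c+1$ and $r-1$. Thus $C=(c+1)\cdots(c+r)$, the same
    for all polynomials. *)
Lemma euler_horner_div r c : exists2 C, (0 < C)%N & forall T M a b,
    T *+ c.+1 + ('X - b%:P) * T^`() = ('X - a%:P) ^+ r * M ->
  exists g, T.[a] *+ C = g * (a - b) ^+ r.
Proof.
elim: r c => [|r IHr] c.
  by exists 1%N => // T M a b _; exists T.[a]; rewrite mulr1.
have [C C0 IH] := IHr c.+1; exists (c.+1 * C)%N; rewrite ?muln_gt0 // => T M a b eT.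
have [|g eg] := IH T^`() (M *+ r.+1 + ('X - a%:P) * M^`()) a b.
  have := congr1 (@deriv _) eT.
  rewrite derivD derivMn !derivM deriv_exp !derivXsubC !mul1r /= addrA -mulrSr => ->.
  by rewrite mulrDr mulrnAl mulrnAr exprSr -!mulrA.
exists (- g); have := congr1 (horner^~ a) eT.
rewrite !hornerE hornerMn subrr exprS !mul0r => /eqP; rewrite addr_eq0 => /eqP e.
by rewrite mulrnA e mulNrn -mulrnAr eg mulNr exprS mulrCA.
Qed.

(** Of the $2k+1$ factors, $k+1$ come from the vanishing of [Psi - Psi.[b]%:P] at $b$, and $k$ from
    the value of the cofactor at $a$. *)
Lemma primitive_div k : exists2 C, (0 < C)%N & forall Psi M a b,
    Psi^`() = ('X - b%:P) ^+ k * (('X - a%:P) ^+ k * M) ->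
  exists g, (Psi.[a] - Psi.[b]) *+ C = g * (a - b) ^+ (2 * k + 1).
Proof.
have [C C0 HC] := euler_horner_div k k; exists C => // Psi M a b dPsi.
have [||T eT eM] := @primitive_divXsubC k (Psi - Psi.[b]%:P) (('X - a%:P) ^+ k * M) b.
- by rewrite derivB derivC subr0.
- by rewrite /root !hornerE subrr.
have [g eg] := HC T M a b eM; exists g.
have := congr1 (horner^~ a) eT; rewrite !hornerE => ->.
by rewrite -mulrnAr eg addn1 mul2n -addnn -addSn exprD mulrCA.
Qed.

End Primitive.

(** * Total degree and degree in one variable for polynomials with polynomial coefficients *)

Section Bidegree.
Variables (n : nat) (R : comNzRingType) (c : 'I_n).
Implicit Types (p q : {poly {mpoly R[n]}}) (F G : {mpoly R[n]}) (u v : 'X_{1..n}).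

Lemma mcoeffM_neq0 F G u : (F * G)@_u != 0 ->
  exists v w, [/\ F@_v != 0, G@_w != 0 & u = (v + w)%MM].
Proof.
rewrite -mcoeff_msupp => /msuppM_le/allpairsP[[v w] /= [Fv Gw ->]].
by exists v, w; rewrite -!mcoeff_msupp.
Qed.

Lemma mcoeff_sum_neq0 (I : finType) (f : I -> {mpoly R[n]}) u :
  (\sum_i f i)@_u != 0 -> exists i, (f i)@_u != 0.
Proof.
have [/existsP[i fi] _|/existsPn f0] := boolP [exists i, (f i)@_u != 0].
  by exists i.
by rewrite raddf_sum /= big1 ?eqxx // => i _; have /negPn/eqP := f0 i.
Qed.

(** The outer variable counts towards [e] but not towards [f], so evaluation at a variable other
    than $x_c$ respects both. *)
Definition bideg (e f : nat) p := forall i u,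
  (p`_i)@_u != 0 -> (mdeg u + i = e)%N /\ (u c <= f)%N.

Lemma bidegM e f e' f' p q :
  bideg e f p -> bideg e' f' q -> bideg (e + e') (f + f') (p * q).
Proof.
move=> bp bq i u; rewrite coefM => /mcoeff_sum_neq0[j].
move=> /mcoeffM_neq0[v [w [/bp[dv cv] /bq[dw cw] ->]]].
by rewrite mdegD mnmDE; have := ltn_ord j; lia.
Qed.

Lemma bideg1 : bideg 0 0 1.
Proof.
move=> i u; rewrite coef1 -mpolyC_nat mcoeffC; have [->|] := eqVneq i 0%N.
  by rewrite mul1r; case: (eqVneq u 0%MM) => [->|]; rewrite ?eqxx // mdeg0 mnm0E.
by rewrite mul0r eqxx.
Qed.

Lemma bidegX e f p k : bideg e f p -> bideg (e * k) (f * k) (p ^+ k).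
Proof.
move=> bp; elim: k => [|k IHk]; first by rewrite !muln0; apply: bideg1.
by rewrite !mulnS exprS; apply: bidegM.
Qed.

Lemma bideg_XsubC i : bideg 1 (i == c) ('X - ('X_i)%:P).
Proof.
move=> j u; rewrite coefB coefX coefC.
case: j => [|[|j]] /=; rewrite ?sub0r ?subr0 ?mcoeffN ?oppr_eq0 ?mcoeff0 ?eqxx //.
  by rewrite mcoeffX; case: (eqVneq U_(i)%MM u) => [<-|]; rewrite ?eqxx // mdeg1 mnm1E.
rewrite -mpolyC1 mcoeffC mul1r; case: (eqVneq u 0%MM) => [->|]; rewrite ?eqxx //.
by rewrite mdeg0 mnm0E.
Qed.

Lemma bideg_prod (I : Type) (r : seq I) (P : pred I) (e f : I -> nat)
    (p : I -> {poly {mpoly R[n]}}) :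
    (forall i, bideg (e i) (f i) (p i)) ->
  bideg (\sum_(i <- r | P i) e i) (\sum_(i <- r | P i) f i) (\prod_(i <- r | P i) p i).
Proof.
move=> bp; elim: r => [|i r IHr]; first by rewrite !big_nil; apply: bideg1.
by rewrite !big_cons; case: ifP => // _; apply: bidegM.
Qed.

Lemma bideg_size e f p : bideg e f p -> (size p <= e.+1)%N.
Proof.
move=> bp; apply/leq_sizeP => i lei; apply/mpolyP => u; rewrite mcoeff0.
by apply/eqP; apply: contraTT lei => /bp[]; lia.
Qed.

Lemma bideg_horner e f p i u : bideg e f p ->
  (p.['X_i])@_u != 0 -> mdeg u = e /\ (i != c -> (u c <= f)%N).
Proof.
move=> bp; rewrite horner_coef => /mcoeff_sum_neq0[j].
move=> /mcoeffM_neq0[v [w [/bp[dv cv]]]].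
rewrite mcoeffXn => w0 ->; have {w0} <- : (U_(i) *+ j)%MM = w.
  by apply/eqP; apply: contraNT w0 => /negPf->.
rewrite mdegD mdegMn mdeg1 mul1n dv; split=> // ic.
by rewrite mnmDE mulmnE mnm1E (negPf ic) addn0.
Qed.

End Bidegree.

(** * Antiderivatives without denominators *)

Section AntiDerivative.
Variable A : comNzRingType.
Implicit Types p : {poly A}.

(* An antiderivative of (size p)`! p with coefficients in A; the junk value x %/ 0 = 0
   makes its constant term vanish. *)
Definition antideriv p : {poly A} :=
  \poly_(i < (size p).+1) (p`_i.-1 *+ ((size p)`! %/ i)).

Lemma antideriv0 p : (antideriv p).[0] = 0.
Proof. by rewrite horner_coef0 coef_poly divn0 mulr0n. Qed.

Lemma deriv_antideriv p : (antideriv p)^`() = p *+ (size p)`!.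
Proof.
apply/polyP => i; rewrite coef_deriv coef_poly coefMn ltnS.
case: ltnP => ip; last by rewrite mul0rn nth_default // mul0rn.
by rewrite -mulrnA divnK // dvdn_fact // ip.
Qed.

End AntiDerivative.

(** * The non-symmetric quasi-invariant over the integers *)

Section RootProductIntegral.
Variables (n k : nat).
Local Notation A := {mpoly int[n]}.
Implicit Types i j : 'I_n.

Definition root_prod : {poly A} := \prod_(i < n) ('X - ('X_i)%:P) ^+ k.
Local Notation Psi := (antideriv root_prod).

Lemma mpoly_int_char0 (F : A) (s : nat) : F *+ s.+1 = 0 -> F = 0.
Proof.
move=> Fs; apply/mpolyP => u; have := congr1 (mcoeff u) Fs.
by rewrite mcoeffMn mcoeff0 => /eqP; rewrite mulrn_eq0 => /eqP.
Qed.

Lemma bideg_root_prod (c : 'I_n) : bideg c (n * k) k root_prod.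
Proof.
have := @bideg_prod _ _ c _ (index_enum 'I_n) xpredT _ _ _
  (fun i => @bidegX n int c _ _ _ k (@bideg_XsubC n int c i)).
rewrite sum_nat_const card_ord mul1n.
rewrite (bigD1 c) //= eqxx mul1n big1 ?addn0 // => i ic.
by rewrite (negPf ic).
Qed.

Lemma bideg_Psi (c : 'I_n) : bideg c (n * k).+1 k Psi.
Proof.
move=> i u; rewrite coef_poly; case: ltnP; rewrite ?mcoeff0 ?eqxx //.
case: i => [|i] _; first by rewrite divn0 mulr0n mcoeff0 eqxx.
rewrite mcoeffMn mulrn_eq0 negb_or => /andP[_ /(@bideg_root_prod c)].
by rewrite /= addnS => -[->].
Qed.

(** Permutations fix [root_prod], hence the coefficients of [Psi]; only the evaluation point
    moves. *)
Lemma msym_Psi (s : 'S_n) i : msym s Psi.['X_i] = Psi.['X_(s i)].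
Proof.
have sN : map_poly (msym s) root_prod = root_prod.
  rewrite rmorph_prod [RHS](reindex_inj (@perm_inj _ s)) /=.
  by apply: eq_bigr => j _; rewrite rmorphXn /= map_polyXsubC /= msymXU.
have sPsi : map_poly (msym s) Psi = Psi.
  apply/polyP => j; rewrite coef_map coef_poly; case: ifP => _; last exact: raddf0.
  by rewrite /= rmorphMn /= -coef_map sN.
by rewrite -{2}sPsi -msymXU horner_map.
Qed.

(** At $x_i=1$ and all other variables 0, [Psi] becomes an antiderivative of a nonzero multiple of
    $(z-1)^k z^{(n-1)k}$. Equal values would make it vanish at 0 and 1, so
    $(z-1)^{k+1}z^{(n-1)k+1}$, of degree $nk+2$, would divide a nonzero polynomial of degree at most
    $nk+1$. *)
Lemma Psi_neq i j : i != j -> Psi.['X_i] != Psi.['X_j].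
Proof.
move=> ij; apply/eqP => ePsi.
have [v [ev1 ev]] : exists v : 'I_n -> int, v i = 1 /\ forall l, l != i -> v l = 0.
  by exists (fun l => (l == i)%:R); split=> [|l /negPf->]; rewrite ?eqxx.
have ev0 : v j = 0 by rewrite ev // eq_sym.
pose psi := map_poly (meval v) Psi.
have vN : map_poly (meval v) root_prod = ('X - 1%:P) ^+ k * ('X - 0%:P) ^+ (n.-1 * k).
  rewrite rmorph_prod (bigD1 i) //; congr (_ * _).
    by rewrite rmorphXn /= map_polyXsubC /= mevalXU ev1.
  rewrite (eq_bigr (fun=> ('X - 0%:P) ^+ k)) => [|l li].
    by rewrite prodr_const cardC1 card_ord -exprM mulnC.
  by rewrite rmorphXn /= map_polyXsubC /= mevalXU ev.
have dpsi : psi^`() = (('X - 1%:P) ^+ k * ('X - 0%:P) ^+ (n.-1 * k)) *+ (size root_prod)`!.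
  by rewrite deriv_map deriv_antideriv rmorphMn -vN.
have psi0 : root psi 0.
  by rewrite /root -[0](rmorph0 (meval v)) horner_map antideriv0 rmorph0.
have psi1 : root psi 1.
  have psiE l : psi.[v l] = meval v Psi.['X_l] by rewrite -[v l](mevalXU v l) horner_map.
  by rewrite /root -ev1 psiE ePsi -psiE ev0.
have int0 (z : int) s : z *+ s.+1 = 0 -> z = 0.
  by move/eqP; rewrite mulrn_eq0 => /eqP.
have [T1 e1 _] := primitive_divXsubC int0 (etrans dpsi (esym (mulrnAr _ _ _))) psi1.
have [T0 e0 _] := primitive_divXsubC int0
  (etrans dpsi (etrans (congr1 (fun p => p *+ _) (mulrC _ _)) (esym (mulrnAr _ _ _)))) psi0.
have psi_neq0 : psi != 0.
  apply: contra_eq_neq dpsi => ->; rewrite deriv0 eq_sym -scaler_nat -mul_polyC.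
  by rewrite !mulf_neq0 ?expf_neq0 ?polyXsubC_eq0 // polyC_eq0 pnatr_eq0 -lt0n fact_gt0.
have : ('X - 1%:P) ^+ k.+1 * ('X - 0%:P) ^+ (n.-1 * k).+1 %| psi.
  rewrite Gauss_dvdp; first by rewrite {1}e1 e0 !dvdp_mulIl.
  apply/coprimep_expl/coprimep_expr; rewrite coprimep_XsubC root_XsubC.
  by rewrite eq_sym oner_neq0.
move/(dvdp_leq psi_neq0).
rewrite size_mul ?expf_neq0 ?polyXsubC_eq0 // !size_exp_XsubC => le_size.
have := leq_trans le_size (leq_trans (size_poly _ _) (bideg_size (bideg_Psi i))).
have -> : (n * k = k + n.-1 * k)%N by rewrite -mulSn prednK // (leq_trans _ (ltn_ord i)).
lia.
Qed.

Lemma exists_quasi_invariant_int (a b c : 'I_n) : a != b -> a != c -> b != c ->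
  exists P : A, [/\ P != 0, P \is (n * k).+1.-homog,
    forall u, P@_u != 0 -> (u c <= k)%N,
    exists G, P = G * ('X_a - 'X_b) ^+ (2 * k + 1) &
    forall i j, exists G, P - msym (tperm i j) P = G * ('X_i - 'X_j) ^+ (2 * k + 1)].
Proof.
move=> ab ac bc; have [C C0 HC] := primitive_div mpoly_int_char0 k.
have dvdPsi i j : i != j ->
    exists G, (Psi.['X_i] - Psi.['X_j]) *+ C = G * ('X_i - 'X_j) ^+ (2 * k + 1).
  move=> ij; have [M eM] : exists M, root_prod =
      ('X - ('X_j)%:P) ^+ k * (('X - ('X_i)%:P) ^+ k * M).
    rewrite /root_prod (bigD1 j) // (bigD1 i) //; eexists; reflexivity.
  apply: (HC _ (M *+ (size root_prod)`!)).
  by rewrite deriv_antideriv !mulrnAr -eM.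
exists ((Psi.['X_a] - Psi.['X_b]) *+ C); split; last 2 first.
- exact: dvdPsi.
- move=> i j; have [->|ij] := eqVneq i j.
    by exists 0; rewrite tperm1 msym1m subrr mul0r.
  (* The difference of [P] and its swap regroups into one such term for $l=a$ minus the one for
     $l=b$. *)
  have dvdl l : exists G,
      (Psi.['X_l] - Psi.['X_(tperm i j l)]) *+ C = G * ('X_i - 'X_j) ^+ (2 * k + 1).
    case: tpermP => [->|->|_ _]; first exact: dvdPsi.
      have [G e] := dvdPsi i j ij; exists (- G).
      by rewrite mulNr -e -mulNrn opprB.
    by exists 0; rewrite subrr mul0rn mul0r.
  have [Ga ea] := dvdl a; have [Gb eb] := dvdl b; exists (Ga - Gb).
  rewrite mulrBl -ea -eb rmorphMn /= msymB !msym_Psi -!mulrnBl.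
  by congr (_ *+ _); ring.
- apply: contra (Psi_neq ab) => /eqP e; rewrite -subr_eq0; apply/eqP.
  by apply: (@mpoly_int_char0 _ C.-1); rewrite prednK.
- have hX i : Psi.['X_i] \is (n * k).+1.-homog.
    apply/dhomogP => u; rewrite mcoeff_msupp => /(bideg_horner (bideg_Psi a)).
    by case.
  by rewrite rpredMn // rpredB.
move=> u; rewrite mcoeffMn mulrn_eq0 negb_or => /andP[_]; rewrite mcoeffB.
have [Pa|/(bideg_horner (bideg_Psi c))[_] /(_ ac) //] := eqVneq (Psi.['X_a])@_u 0.
rewrite Pa sub0r oppr_eq0.
by move=> /(bideg_horner (bideg_Psi c))[_] /(_ bc).
Qed.

End RootProductIntegral.

(** * Reduction modulo $p$ *)

Section ModularReduction.
Variables (n : nat) (K : fieldType) (p : nat).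
Hypothesis pcharK : p \in [pchar K].
Local Notation red := (map_mpoly (intr : int -> K)).
Implicit Types (F G H : {mpoly int[n]}) (i j : 'I_n).

Lemma red_eq0 F : red F = 0 -> exists F', F = F' *+ p.
Proof.
move=> redF; exists (\sum_(u <- msupp F) (F@_u %/ p)%Z *: 'X_[u]).
rewrite {1}[F]mpolyE -sumrMnl; apply: eq_bigr => u _.
rewrite scalerMnl -mulr_natr natz divzK // (dvdz_pcharf pcharK) -mcoeff_map_mpoly.
by rewrite redF mcoeff0.
Qed.

Lemma mulrn_prime_inj F G : F *+ p = G *+ p -> F = G.
Proof.
move=> e; apply/eqP; rewrite -subr_eq0; apply/eqP; apply: (@mpoly_int_char0 _ _ p.-1).
rewrite prednK ?prime_gt0 ?(pcharf_prime pcharK) //.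
by rewrite mulrnBl e subrr.
Qed.

Lemma redXB i j N G : red (G * ('X_i - 'X_j) ^+ N) = red G * ('X_i - 'X_j) ^+ N.
Proof. by rewrite rmorphM rmorphXn rmorphB /= !map_mpolyX. Qed.

(** Modulo $p$, $x_i-x_j$ is still not a zero divisor, so $p$ must divide [G]. *)
Lemma divide_mulXB i j N H G : i != j ->
  H *+ p = G * ('X_i - 'X_j) ^+ N -> exists G', H = G' * ('X_i - 'X_j) ^+ N.
Proof.
move=> ij e; have /red_eq0[G' eG] : red G = 0.
  apply: (mulXB_exp_eq0 ij (N := N)) => u _; rewrite -redXB -e rmorphMn /=.
  by rewrite -mulr_natr -mpolyC_nat (pcharf0 pcharK) mpolyC0 mulr0 mcoeff0.
by exists G'; apply: mulrn_prime_inj; rewrite e eG mulrnAl.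
Qed.

(** The integral polynomial is divided by $p$ until its reduction is nonzero, which preserves all
    its properties. This stops because the absolute value of a fixed nonzero coefficient
    decreases. *)
Lemma exists_quasi_invariant_pchar (k : nat) (a b c : 'I_n) :
    a != b -> a != c -> b != c ->
  exists P : {mpoly K[n]}, [/\ P != 0, P \is (n * k).+1.-homog,
    forall u, P@_u != 0 -> (u c <= k)%N,
    exists G : {mpoly K[n]}, P = G * ('X_a - 'X_b) ^+ (2 * k + 1) &
    forall i j, exists G : {mpoly K[n]}, P - msym (tperm i j) P = G * ('X_i - 'X_j) ^+ (2 * k + 1)].
Proof.
move=> ab ac bc; have [P [P0]] := exists_quasi_invariant_int k ab ac bc.
have [u Pu] : exists u, P@_u != 0.
  by exists (mlead P); rewrite mleadc_eq0.
move: {P0}P Pu => P; have [s] := ubnP `|P@_u|%N.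
elim: s P => // s IHs P ltP Pu homP degP [G eG] qP.
have [redP|redP] := eqVneq (red P) 0; last first.
  exists (red P); split=> //.
  - apply/dhomogP => v; rewrite mcoeff_msupp mcoeff_map_mpoly => Pv.
    apply: (dhomog_mf homP); rewrite mcoeff_msupp.
    by apply: contraNneq Pv => ->.
  - move=> v; rewrite mcoeff_map_mpoly => Pv; apply: degP.
    by apply: contraNneq Pv => ->.
  - by exists (red G); rewrite -redXB -eG.
  move=> i j; have [Gij e] := qP i j; exists (red Gij); rewrite -redXB -e rmorphB /=.
  by congr (_ - _); apply/mpolyP => v; rewrite mcoeff_sym !mcoeff_map_mpoly mcoeff_sym.
have [P' eP] := red_eq0 redP.
have cP v : P@_v = P'@_v *+ p by rewrite eP mcoeffMn.
have p_gt1 := prime_gt1 (pcharf_prime pcharK).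
have P'0 v : P'@_v != 0 -> P@_v != 0.
  by rewrite cP mulrn_eq0 negb_or => ->; rewrite -lt0n ltnW.
apply: (IHs P').
- move: Pu ltP; rewrite cP -mulr_natr natz abszM absz_nat; move: (P'@_u) => x.
  by rewrite mulf_eq0 negb_or -absz_gt0 => /andP[x0 _]; nia.
- by apply: contraNneq Pu; rewrite cP => ->; rewrite mul0rn.
- apply/dhomogP => v; rewrite mcoeff_msupp => /P'0; rewrite -mcoeff_msupp.
  exact: (dhomog_mf homP).
- by move=> v /P'0/degP.
- by apply: (divide_mulXB (G := G)); rewrite // -eP.
move=> i j; have [->|ij] := eqVneq i j.
  by exists 0; rewrite tperm1 msym1m subrr mul0r.
have [Gij e] := qP i j; apply: (divide_mulXB (G := Gij)) => //.
by rewrite -e eP mulrnBl rmorphMn.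
Qed.

End ModularReduction.

(** * The Vandermonde product *)

Section DifferenceProduct.
Variables (n : nat) (K : fieldType).
Local Notation A := {mpoly K[n]}.
Implicit Types i j : 'I_n.

Definition diff_prod : A := \prod_(ij : 'I_n * 'I_n | (ij.2 < ij.1)%N) ('X_ij.1 - 'X_ij.2).

Lemma mpolyXB_neq0 i j : i != j -> 'X_i - 'X_j != 0 :> A.
Proof.
move=> ij; apply/eqP => /(congr1 (mcoeff U_(i)%MM)) /eqP.
by rewrite mcoeffB !mcoeffXU eqxx [j == i]eq_sym (negPf ij) subr0 mcoeff0 oner_eq0.
Qed.

Lemma diff_prod_neq0 : diff_prod != 0.
Proof.
apply/prodf_neq0 => -[i j] /= ji; apply: mpolyXB_neq0.
by apply: contraTneq ji => ->; rewrite ltnn.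
Qed.

Lemma diff_prod_homog : diff_prod \is 'C(n, 2).-homog.
Proof.
have -> : 'C(n, 2) = (\sum_(ij : 'I_n * 'I_n | (ij.2 < ij.1)%N) 1)%N.
  rewrite -(pair_big_dep xpredT (fun i j : 'I_n => (j < i)%N) (fun _ _ => 1%N)) /=.
  rewrite -bin2_sum big_mkord; apply: eq_bigr => i _.
  by rewrite (big_ord_narrow (ltnW (ltn_ord i))) sum_nat_const card_ord muln1.
rewrite /diff_prod; elim/big_rec2: _ => [|ij d F _ hF]; first exact: dhomog1.
have hX l : ('X_l : A) \is 1.-homog by rewrite dhomogX; apply/eqP/mdeg1.
by apply: dhomogM => //; rewrite rpredB.
Qed.

Lemma diff_prod_div i j : i != j -> exists G, diff_prod = G * ('X_i - 'X_j).
Proof.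
move=> ij; wlog ji : i j ij / (j < i)%N.
  move=> W; have [ji|ij'|e] := ltngtP j i; first exact: W; last by rewrite (ord_inj e) eqxx in ij.
  have [|G e] := W j i _ ij'; first by rewrite eq_sym.
  by exists (- G); rewrite mulNr -mulrN opprB.
rewrite /diff_prod (bigD1 (i, j)) //= mulrC; eexists; reflexivity.
Qed.

(** The product over all ordered pairs is invariant and equals the square of [diff_prod] up to sign,
    so that square is invariant. *)
Lemma msym_diff_prod (s : 'S_n) :
  msym s diff_prod = diff_prod \/ msym s diff_prod = - diff_prod.
Proof.
pose W : A := \prod_(ij : 'I_n * 'I_n | ij.1 != ij.2) ('X_ij.1 - 'X_ij.2).
have sW : msym s W = W.
  rewrite rmorph_prod [RHS](reindex (fun ij => (s ij.1, s ij.2))) /=; last first.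
    exists (fun ij => (s^-1 ij.1, s^-1 ij.2)%g) => -[i j] _ /=.
      by rewrite !permK.
    by rewrite !permKV.
  apply: eq_big => [[i j]|[i j] _] /=; first by rewrite (inj_eq perm_inj).
  by rewrite rmorphB /= !msymXU.
have eW : W = (-1) ^+ #|[pred ij : 'I_n * 'I_n | (ij.2 < ij.1)%N]| * diff_prod ^+ 2.
  rewrite expr2 mulrA -prodrN /diff_prod.
  rewrite /W (bigID (fun ij : 'I_n * 'I_n => (ij.1 < ij.2)%N)) /=; congr (_ * _).
    rewrite (reindex (fun ij => (ij.2, ij.1))) /=; last first.
      by exists (fun ij => (ij.2, ij.1)) => -[].
    apply: eq_big => [[i j]|[i j] _] /=; last by rewrite opprB.
    by rewrite andb_idl // => ji; rewrite eq_sym; apply: contraTneq ji => ->; rewrite ltnn.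
  by apply: eq_bigl => -[i j] /=; rewrite -leqNgt ltn_neqAle eq_sym.
have s0 : (-1) ^+ #|[pred ij : 'I_n * 'I_n | (ij.2 < ij.1)%N]| != 0 :> A.
  by rewrite signr_eq0.
move: sW; rewrite eW msymM !rmorphXn /= msymN msym1 => /(mulfI s0)/eqP.
by rewrite eqf_sqr => /orP[/eqP|/eqP]; [left|right].
Qed.

End DifferenceProduct.

(** * Comparison of the two characteristics *)

Lemma low_degree_quasi_invariant_symmetric (K : fieldType) (m n d : nat)
    (F : hompoly n K d) :
    (forall (c : K) (s : nat), c *+ s.+1 = 0 -> c = 0) -> (d <= m * n)%N ->
  quasi_invariant m (F : {mpoly K[n]}) -> (F : {mpoly K[n]}) \is symmetric.
Proof.
move=> char0 dmn QF.
have tF i j : msym (tperm i j) (F : {mpoly K[n]}) = F.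
  apply: (low_degree_sym char0 (m := m) (S := [set: 'I_n])); rewrite ?inE // => u Fu.
  rewrite cardsT card_ord; apply: leq_trans dmn.
  have := dhomog_mf (dhomog_is_dhomog F); rewrite -mcoeff_msupp in Fu.
  move=> /(_ u Fu) <-; rewrite [X in (_ <= X)%N]mdegE; apply: eq_leq.
  by apply: eq_bigl => i'; rewrite inE.
apply/issymP => s; have [ts -> _] := prod_tpermP s.
elim: ts => [|t ts IHts]; first by rewrite big_nil msym1m.
by rewrite big_cons msymMm tF.
Qed.

(** The $q$-th power is additive, so it multiplies the order of divisibility $2k+1$ by $q$; the
    symmetric factor [V ^+ c] supplies what is missing up to $2m+1$. Truncated subtraction makes [c]
    zero if nothing is missing. *)
Lemma nonsymmetric_quasi_invariant (p m n k a : nat) :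
    prime p -> (2 < n)%N ->
  let q := (p ^ a)%N in let c := (2 * m + 1 - (2 * k + 1) * q)%N in
  let d := ((n * k).+1 * q + 'C(n, 2) * c)%N in
  exists F : hompoly n 'F_p d,
    quasi_invariant m (F : {mpoly 'F_p[n]}) /\ (F : {mpoly 'F_p[n]}) \isn't symmetric.
Proof.
move=> pp n2 q c d; have pcharK := pchar_Fp pp.
pose i0 := Ordinal (ltnW (ltnW n2)); pose i1 := Ordinal (ltnW n2); pose i2 := Ordinal n2.
have [//|//|//|P [P0 homP degP [G eG] qP]] :=
  @exists_quasi_invariant_pchar n 'F_p p pcharK k i0 i1 i2.
set V := diff_prod n 'F_p.
have pcharA : p \in [pchar {mpoly 'F_p[n]}].
  by rewrite inE pp -mpolyC_nat (pcharf0 pcharK) mpolyC0 eqxx.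
have qA : [pchar {mpoly 'F_p[n]}].-nat q.
  by rewrite (eq_pnat _ (pcharf_eq pcharA)) pnatX pnat_id.
have expB (F H : {mpoly 'F_p[n]}) : (F - H) ^+ q = F ^+ q - H ^+ q.
  by apply/eqP; rewrite eq_sym subr_eq -exprDn_pchar // subrK.
(* For odd $p$, [c] is zero or a difference of two odd numbers; for $p=2$, $-1=1$. *)
have sign_c : (-1) ^+ c = 1 :> {mpoly 'F_p[n]}.
  have [p2|p_odd] := even_prime pp.
    suff -> : -1 = 1 :> {mpoly 'F_p[n]} by rewrite expr1n.
    apply/eqP; rewrite eq_sym -addr_eq0 -mulr2n.
    by have := pcharf0 pcharA; rewrite p2 => /eqP.
  rewrite -signr_odd; suff -> : odd c = false by [].
  rewrite /c; have [le|/ltnW] := leqP ((2 * k + 1) * q) (2 * m + 1).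
    by rewrite oddB // !(oddD, oddM) /= oddX p_odd orbT.
  by rewrite -subn_eq0 => /eqP->.
have symV s : msym s (V ^+ c) = V ^+ c.
  rewrite rmorphXn /=; have [->//|->] := msym_diff_prod 'F_p s.
  by rewrite exprNn sign_c mul1r.
have homF : P ^+ q * V ^+ c \is d.-homog.
  by apply: dhomogM; apply: dhomogMn => //; apply: diff_prod_homog.
exists (DHomog homF : hompoly n 'F_p d); rewrite /=.
have symF s : P ^+ q * V ^+ c - msym s (P ^+ q * V ^+ c) =
    (P - msym s P) ^+ q * V ^+ c.
  by rewrite msymM symV rmorphXn /= -mulrBl expB.
split.
  move=> i j; have [->|ij] := eqVneq i j.
    by exists 0; rewrite tperm1 msym1m subrr mul0r.
  have [H eH] := qP i j; have [W eW] := diff_prod_div 'F_p ij.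
  exists (H ^+ q * W ^+ c * ('X_i - 'X_j) ^+ ((2 * k + 1) * q + c - (2 * m + 1))).
  rewrite symF eH /V eW; move: ('X_i - 'X_j) => D.
  rewrite !exprMn -exprM mulrACA -exprD -[RHS]mulrA -exprD subnK // /c.
  by lia.
apply: contra P0 => /issymP sF.
have sP : msym (tperm i0 i2) P = P.
  have /eqP := symF (tperm i0 i2); rewrite sF subrr eq_sym mulf_eq0.
  rewrite [_ || (V ^+ c == 0)]orbC expf_eq0 (negPf (diff_prod_neq0 _ _)) andbF /=.
  by rewrite expf_eq0 subr_eq0 => /andP[_ /eqP].
(* By symmetry the degree bound $k$ in the third variable also holds in the first, too small for a
   nonzero multiple of $(x_1-x_2)^{2k+1}$. *)
rewrite eG (@mulXB_exp_eq0l _ _ i0 i1 G (2 * k + 1)) ?mul0r // -eG => u ku.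
apply/eqP; apply: contraTT ku => Pu.
have := degP (u # tperm i0 i2); rewrite -mcoeff_sym sP mnmE tpermR => /(_ Pu).
by rewrite -ltnNge => /leq_ltn_trans -> //; lia.
Qed.

(** If the truncated difference is 0, the upper bound on [q] is the claim. Otherwise $2\binom
    n2=n(n-1)$ turns the claim into the lower bound with its denominator cleared. *)
Lemma degree_bound (m n k q : nat) : (2 < n)%N ->
    ((m%:R * n%:R * (n%:R - 2) + 'C(n, 2)%:R)
       / (n%:R * (n%:R - 2) * k%:R + 'C(n, 2)%:R - 1) <= q%:R :> rat) ->
    (q%:R <= (m%:R * n%:R) / (n%:R * k%:R + 1) :> rat) ->
  ((n * k).+1 * q + 'C(n, 2) * (2 * m + 1 - (2 * k + 1) * q) <= m * n)%N.
Proof.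
case: n => [|[|N]] // N0 le1 le2; set C := 'C(_, 2) in le1 *.
have eC : (2 * C = N.+2 * N.+1)%N by rewrite -mul_bin_diag bin1.
have C1 : (1 < C)%N by nia.
have eN : N.+2%:R - 2 = N%:R :> rat by rewrite -addn2 natrD addrK.
rewrite eN -addrA -(@natrB _ _ 1) 1?ltnW // in le1.
rewrite -!natrM -!natrD ler_pdivrMr in le1; last by rewrite ltr0n; lia.
rewrite -!natrM natr1 ler_pdivlMr ?ltr0n // in le2.
rewrite -!natrM !ler_nat in le1 le2.
have [|lt] := leqP (2 * m + 1) ((2 * k + 1) * q).
  by rewrite -subn_eq0 => /eqP ->; lia.
have e1 : (2 * C * m = N.+2 * N.+1 * m)%N by rewrite eC.
have e2 : (2 * C * k * q = N.+2 * N.+1 * k * q)%N by rewrite eC.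
nia.
Qed.

Theorem theorem2p6 (R : realType) (m n : nat) (hn : (3 <= n)%N)
    (p : nat) (hp : prime p)
    (hpak : exists a k : nat,
        ((m%:R * n%:R * (n%:R - 2) + 'C(n, 2)%:R)
           / (n%:R * (n%:R - 2) * k%:R + 'C(n, 2)%:R - 1) <= p%:R ^+ a :> rat)
        /\ (p%:R ^+ a <= (m%:R * n%:R) / (n%:R * k%:R + 1) :> rat)) :
  hilbert_series 'F_p m n <> hilbert_series R[i] m n.
Proof.
case: hpak => a [k []]; rewrite -natrX => le1 le2 eH.
have [F [QF nsF]] := nonsymmetric_quasi_invariant m k a hp hn.
have := hilbert_series_lt (L := R[i]) _ QF nsF.
rewrite eH ltnn => /(_ _)/negP[] // G.
apply: low_degree_quasi_invariant_symmetric; last exact: degree_bound le1 le2.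
by move=> c s /eqP; rewrite mulrn_eq0 => /eqP.
Qed.
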